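(* Let $\mathcal{X}$ and $\mathcal{Y}$ be Polish spaces with their Borel $\sigma$-algebras, let $\mu$ and $\gamma$ be probability measures on $\mathcal{X}$ and $\mathcal{Y}$ respectively, and let $F:\mathcal{X}\times\mathcal{Y}\to\mathbb{R}$ be Borel measurable. For $c\in(0,\infty)$ define $$\Lambda_c=\frac1c\log\int_{\mathcal{X}}\int_{\mathcal{Y}}e^{cF(x,y)}\gamma(dy)\mu(dx),$$ $$\Lambda_c^1=\frac1c\log\int_{\mathcal{Y}}\exp\left(\int_{\mathcal{X}}cF(x,y)\mu(dx)\right)\gamma(dy),$$ $$\Lambda_c^2=\frac1c\int_{\mathcal{X}}\left[\log\int_{\mathcal{Y}}e^{cF(x,y)}\gamma(dy)\right]\mu(dx).$$ Let $L_c$ denote any one of the three functionals $\Lambda_c,\Lambda_c^1,\Lambda_c^2$ (the assertions hold for each of them separately), assumed to be well defined with values in $(-\infty,\infty]$ for all $c\in(0,\infty)$, and let $D=\{c\in(0,\infty):L_c<\infty\}$. Assume that the interior of $D$ is nonempty. Then: (a) $c\mapsto L_c$ is differentiable on the interior of $D$. (b) If in addition $F\ge 0$, then $c\mapsto L_c$ is nondecreasing for $c\ge0$ (with $L_0:=\lim_{c\downarrow0}L_c$). (c) If in addition $F\ge0$ and $B>0$ is given, then there is a unique $c\in(0,\infty]$ at which $$c\mapsto\frac1cB+L_c$$ attains a local minimum, where the statement that the minimum occurs at $c=\infty$ means that the limit $L_\infty=\lim_{c\to\infty}L_c$ is well defined and $L_c+B/c>L_\infty$ for all $c\in(0,\i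nfty)$.
   Context: Integrals may take the value $+\infty$, with the conventions $e^{\infty}=\infty$ and $\log\infty=\infty$. In (c), a finite point $c\in(0,\infty)$ is a local minimum of $g(c)=B/c+L_c$ if $g(c)<\infty$ and $g(c)\le g(c')$ for all $c'\in(0,\infty)$ in some neighborhood of $c$. *)

(* Defs.v *)
From HB Require Import structures.
From mathcomp Require Import all_boot all_order all_algebra.
From mathcomp Require Import all_classical all_reals all_analysis.
Set Implicit Arguments.
Unset Strict Implicit.
Unset Printing Implicit Defensive.
Import Order.TTheory GRing.Theory Num.Theory.
Import numFieldNormedType.Exports.
Local Open Scope classical_set_scope.
Local Open Scope ring_scope.

(* Separable and completely metrizable. The metric is not part of the data,
   only the topology of T is. *)
Definition polish (R : realType) (T : topologicalType) : Prop :=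
  (exists2 S : set T, countable S & dense S) /\
  exists d : T -> T -> R,
    [/\ [/\ forall x y, 0 <= d x y,
            forall x y, d x y = 0 <-> x = y,
            forall x y, d x y = d y x
          & forall x y z, d x z <= d x y + d y z],
        (forall x (A : set T),
           nbhs x A <-> exists2 e : R, 0 < e & [set y | d x y < e] `<=` A)
      & (forall u : nat -> T,
           (forall e : R, 0 < e ->
              exists N : nat, forall m n : nat,
                (N <= m)%N -> (N <= n)%N -> d (u m) (u n) < e) ->
           exists l : T, u @ \oo --> l)].

(* The carrier T with its Borel sigma-algebra. *)
Notation borel T := (g_sigma_algebraType (@open T)).

(* The integral of f exists in [-oo, +oo], that is, it is not of the form
   (+oo) - (+oo). The library integral is total (with value -oo in that case),
   so existence has to be said separately. *)
Definition has_integral d (T : measurableType d) (R : realType)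
    (mu : {measure set T -> \bar R}) (f : T -> \bar R) : Prop :=
  (\int[mu]_x f^\+ x < +oo \/ \int[mu]_x f^\- x < +oo)%E.

Variant functional := Lambda | Lambda1 | Lambda2.

Section functionals.
Context (R : realType) (X Y : ptopologicalType).
Context (mu : probability (borel X) R) (gamma : probability (borel Y) R).
Context (F : X * Y -> R).
Local Open Scope ereal_scope.

(* expeR and lne are the exponential and the logarithm on \bar R; they satisfy
   expeR +oo = +oo, lne +oo = +oo, expeR -oo = 0 and lne 0 = -oo. *)
Definition L_ (k : functional) (c : R) : \bar R :=
  match k with
  | Lambda =>
      c^-1%:E * lne (\int[mu]_x \int[gamma]_y (expR (c * F (x, y)))%:E)
  | Lambda1 =>
      c^-1%:E * lne (\int[gamma]_y expeR (\int[mu]_x (c * F (x, y))%:E))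
  | Lambda2 =>
      c^-1%:E * \int[mu]_x lne (\int[gamma]_y (expR (c * F (x, y)))%:E)
  end.

(* Only the integrals of integrands of non-constant sign can fail to exist:
   the inner one of Lambda1, needed for almost every y, and the outer one
   of Lambda2. *)
Definition well_defined (k : functional) (c : R) : Prop :=
  match k with
  | Lambda => True
  | Lambda1 =>
      {ae gamma, forall y, has_integral mu (fun x => (c * F (x, y))%:E)}
  | Lambda2 =>
      has_integral mu (fun x => lne (\int[gamma]_y (expR (c * F (x, y)))%:E))
  end.

End functionals.

Section functions_of_c.
Context (R : realType).
Implicit Types (L : R -> \bar R) (B : R).
Local Open Scope ereal_scope.

Definition finite_domain L : set R := [set c | (0 < c)%R /\ L c < +oo].

Definition extend0 L (c : R) : \bar R :=
  if (c == 0)%R then lim (L t @[t --> 0%R^'+]) else L c.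

Definition objective L B (c : R) : \bar R := (c^-1 * B)%:E + L c.

Definition local_min_at L B (c : \bar R) : Prop :=
  match c with
  | r%:E => [/\ (0 < r)%R, objective L B r < +oo
      & \forall t \near r, (0 < t)%R -> objective L B r <= objective L B t]
  | +oo => cvg (L t @[t --> +oo%R]) /\
      (forall t : R, (0 < t)%R -> lim (L s @[s --> +oo%R]) < objective L B t)
  | -oo => False
  end.

End functions_of_c.

(* Main.v *)
(* For a probability P and a function Z with values in [-oo, +oo], let
   cgf P Z c be the logarithm of the integral of e^(cZ). Each of the three
   functionals is (1/c) times an average over mu of cumulant generating
   functions cgf P (Z x) c: for Lambda, P is the product measure and Z x = F;
   for Lambda1, P = gamma and Z x is the partial integral of F (in both cases
   Z x does not depend on x); for Lambda2, P = gamma and Z x = F(x, -).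
   (a) e^(cZ) and cgf P Z c are convex in c, so their difference quotients at
   c are dominated by those at c - e and c + e, and dominated convergence gives
   differentiability, first under P and then under mu.
   (b) cgf P Z is convex and vanishes at 0, so (1/c) cgf P Z c is nondecreasing.
   (c) As c L_c is convex, a local minimum of B/c + L_c is a global one. If two
   different points were minimal, c L_c would be affine between them; equality
   in the convexity inequality forces Z x to be constant, so L_c would be
   constant there while B/c is not. For existence, let m be the infimum of
   B/c + L_c. If it is not attained, then by lower semicontinuity and
   compactness the infimum over (0, M] exceeds m for every M, so L_M <= m, and
   the minimum is at infinity. *)
Require Import Defs.
From HB Require Import structures.
From mathcomp Require Import all_boot all_order all_algebra.
From mathcomp Require Import all_classical all_reals all_analysis.
From mathcomp Require Import measurable_realfun ring lra.
Import Order.TTheory GRing.Theory Num.Theory.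
Import numFieldNormedType.Exports.
Local Open Scope classical_set_scope.
Local Open Scope ring_scope.
Set Implicit Arguments.
Unset Strict Implicit.
Unset Printing Implicit Defensive.

(** * Differentiation of integrals of convex functions *)

Section DerivIntegral.
Context d (T : measurableType d) (R : realType).
Variables (mu : {measure set T -> \bar R}) (f : R -> T -> R) (c e : R).

(** Slopes of a convex function increase, so the slope between [c] and [c + h] lies between those
    over [[c - e, c]] and [[c, c + e]]. The bound is free of [h] and serves as the dominating
    function. *)
Lemma convex_quotient_bound (g : R -> R) (h : R) : 0 < e ->
  (forall a b th : R, `|a - c| <= e -> `|b - c| <= e -> 0 <= th -> th <= 1 ->
     g (th * a + (1 - th) * b) <= th * g a + (1 - th) * g b) ->
  h != 0 -> `|h| <= e ->
  `|h^-1 * (g (h + c) - g c)| <=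
    e^-1 * (`|g (c + e) - g c| + `|g c - g (c - e)|).
Proof.
move=> e0 cvx h0 he.
have [k0 k1] : 0 <= `|h| / e /\ `|h| / e <= 1.
  by split; rewrite ?ler_pdivrMr ?mul1r// divr_ge0// ltW.
set k := `|h| / e in k0 k1.
have ke : `|h| = k * e by rewrite /k divfK// gt_eqF.
clearbody k.
have cc : `|c - c| <= e by rewrite subrr normr0 ltW.
have cr : `|(c + e) - c| <= e by rewrite addrC addKr gtr0_norm.
have cl : `|(c - e) - c| <= e by rewrite addrC addKr normrN gtr0_norm.
have hp : 0 < `|h| by rewrite normr_gt0.
have hc : `|h + c - c| <= e by rewrite addrK.
(* The sign [s] of [h] treats both sides at once. Convexity is used twice: [h + c] lies between [c]
   and [c + s * e], and [c] lies between [h + c] and [c - s * e], with weight [(1 + k)^-1] on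
   [h + c]. *)
have key (s : R) : s = 1 \/ s = -1 -> h = s * `|h| ->
    `|g (h + c) - g c| <= k * (`|g (c + s * e) - g c| + `|g c - g (c - s * e)|).
  move=> s1 hs.
  have cs : `|(c + s * e) - c| <= e by case: s1 => ->; rewrite ?mul1r ?mulN1r.
  have cs' : `|(c - s * e) - c| <= e.
    by case: s1 => ->; rewrite ?mul1r ?mulN1r ?opprK.
  have := cvx _ _ _ cs cc k0 k1.
  have -> : k * (c + s * e) + (1 - k) * c = h + c.
    by rewrite [in RHS]hs ke; ring.
  have k'0 : 0 <= (1 + k)^-1 by rewrite invr_ge0; lra.
  have k'1 : (1 + k)^-1 <= 1 by rewrite invf_le1; lra.
  have kk : 1 + k != 0 by rewrite gt_eqF//; lra.
  have := cvx _ _ _ hc cs' k'0 k'1.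
  have -> : (1 + k)^-1 * (h + c) + (1 - (1 + k)^-1) * (c - s * e) = c.
    by rewrite [in LHS]hs ke; field.
  rewrite -[X in X <= _ -> _](mulKf kk).
  have -> : (1 + k)^-1 * g (h + c) + (1 - (1 + k)^-1) * g (c - s * e) =
     (1 + k)^-1 * (g (h + c) + k * g (c - s * e)) by field.
  rewrite ler_pM2l; last by rewrite invr_gt0; lra.
  move=> A1 A2.
  have B1 := ler_norm (g (c + s * e) - g c).
  have B2 := ler_norm (g (c - s * e) - g c).
  rewrite distrC in B2.
  have := ler_wpM2l k0 B1; have := ler_wpM2l k0 B2.
  have := mulr_ge0 k0 (normr_ge0 (g (c + s * e) - g c)).
  have := mulr_ge0 k0 (normr_ge0 (g c - g (c - s * e))).
  by rewrite ler_norml => C1 C2 C3 C4; rewrite mulrDr; apply/andP; split; lra.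
rewrite normrM normfV ler_pdivrMl// ke -(mulrA k) mulVKf ?gt_eqF//.
have [h1|h1] := ltP 0 h.
  have := key 1 (or_introl erefl).
  by rewrite !mul1r (gtr0_norm h1) => /(_ erefl).
have := key (-1) (or_intror erefl).
rewrite !mulN1r opprK (ler0_norm h1) opprK => /(_ erefl).
by rewrite (distrC (g c) (g (c + e))) (distrC (g (c - e)) (g c)) [X in k * X]addrC.
Qed.

Hypothesis e0 : 0 < e.
Hypothesis fi : forall s, `|s - c| <= e -> mu.-integrable setT (EFin \o f s).
Hypothesis fc : {ae mu, forall t,
  (forall a b th : R, `|a - c| <= e -> `|b - c| <= e -> 0 <= th -> th <= 1 ->
     f (th * a + (1 - th) * b) t <= th * f a t + (1 - th) * f b t) /\
  derivable (f ^~ t) c 1}.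

Let q h t := h^-1 * (f (h + c) t - f c t).
Let u0 n : R := e / n.+1%:R.
(* The derivative exists only almost everywhere; the upper limit is a
   measurable version of it. *)
Let G t : \bar R := limn_esup (fun n => (q (u0 n) t)%:E).

Let ce : `|c - c| <= e.
Proof. by rewrite subrr normr0 ltW. Qed.

Let he h : `|h| <= e -> `|h + c - c| <= e.
Proof. by rewrite addrK. Qed.

Let qi h : `|h| <= e -> mu.-integrable setT (EFin \o q h).
Proof.
move=> hh; have := integrableZl measurableT h^-1
  (integrableB measurableT (fi (he hh)) (fi ce)).
by apply: eq_integrable.
Qed.

Let u0e n : `|u0 n| <= e.
Proof.
rewrite ger0_norm; last by rewrite divr_ge0// ltW.
by rewrite ler_pdivrMr// ler_peMr ?ler1n// ltW.
Qed.

Let mG : measurable_fun [set: T] G.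
Proof.
apply: measurable_fun_limn_esup => n; exact: measurable_int (qi (u0e n)).
Qed.

Let q_cvg t (u : nat -> R) : derivable (f ^~ t) c 1 -> (forall n, u n != 0) ->
  u n @[n --> \oo] --> 0 -> (q (u n) t) @[n --> \oo] --> derive (f ^~ t) c 1.
Proof.
move=> df u0' ucv.
have uc : u n @[n --> \oo] --> (0 : R)^'.
  move=> A hA; have [N _ NA] := ucv _ hA.
  by exists N => // n /= Nn; exact: NA n Nn (u0' n).
have := cvg_comp _ _ uc df.
apply: cvg_trans; apply: near_eq_cvg; near=> n => /=.
by rewrite /q /= -[u n *: 1]/(u n * 1) mulr1.
Unshelve. all: by end_near. Qed.

Let u0_cvg : u0 n @[n --> \oo] --> 0.
Proof.
rewrite -(mulr0 e); apply: cvgM; first exact: cvg_cst.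
exact: cvg_harmonic.
Qed.

Let u0_neq0 n : u0 n != 0.
Proof. by rewrite gt_eqF// divr_gt0. Qed.

Let cvg_EFinW (u : nat -> R) l :
  u n @[n --> \oo] --> l -> (u n)%:E @[n --> \oo] --> l%:E.
Proof. by move=> ul; apply: cvg_EFin => //; exact: nearW. Qed.

Let G_derive t : derivable (f ^~ t) c 1 -> G t = (derive (f ^~ t) c 1)%:E.
Proof.
move=> df; have := q_cvg df u0_neq0 u0_cvg => /cvg_EFinW qc.
rewrite /G is_cvg_limn_esupE; first exact: cvg_lim.
by apply/cvg_ex; eexists; exact: qc.
Qed.

(** Dominated convergence along [u]. The limit is the same for every [u], because [G] is almost
    everywhere the derivative. *)
Let seq_cvg (u : nat -> R) : (forall n, u n != 0) -> (forall n, `|u n| <= e) ->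
  u n @[n --> \oo] --> 0 ->
  (u n)^-1 * (Rintegral mu setT (f (u n + c)) - Rintegral mu setT (f c))
    @[n --> \oo] --> fine (\int[mu]_t G t)%E.
Proof.
move=> u0' ue ucv.
pose g t := (e^-1 * (`|f (c + e) t - f c t| + `|f c t - f (c - e) t|))%:E.
have cr : `|(c + e) - c| <= e by rewrite addrC addKr gtr0_norm.
have cl : `|(c - e) - c| <= e by rewrite addrC addKr normrN gtr0_norm.
have ig : mu.-integrable setT g.
  apply: eq_integrable (integrableZl measurableT e^-1 (integrableD measurableT
    (integrable_norm (integrableB measurableT (fi cr) (fi ce)))
    (integrable_norm (integrableB measurableT (fi ce) (fi cl))))) => //.
have [||iG _ cG] := @dominated_convergence _ _ _ mu setT measurableT
  (fun n t => (q (u n) t)%:E) G g (fun n => measurable_int _ (qi (ue n))) mG _ ig.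
- apply: filterS fc => t [_ df] _; rewrite G_derive//.
  by apply: cvg_EFinW; exact: q_cvg.
- apply: filterS fc => t [cvx _] n _; rewrite lee_fin.
  exact: (convex_quotient_bound e0 cvx).
have fG := integrable_fin_num measurableT iG.
move: cG; rewrite -(fineK fG) => /fine_cvg; apply: cvg_trans.
apply: near_eq_cvg; near=> n => /=.
rewrite -/(Rintegral mu setT (q (u n))).
rewrite RintegralZl ?RintegralB//; [exact: fi (he (ue n))|exact: fi|].
by apply: eq_integrable (integrableB measurableT (fi (he (ue n))) (fi ce)).
Unshelve. all: by end_near. Qed.

(** Dominated convergence concerns sequences; the limit at 0 is recovered from all sequences of
    nonzero numbers tending to 0. *)
Lemma derivable_Rintegral :
  derivable (fun s => Rintegral mu setT (f s)) c 1.
Proof.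
apply/cvg_ex; exists (fine (\int[mu]_t G t)%E).
have gen (u : nat -> R) : (forall n, u n != 0) -> u n @[n --> \oo] --> 0 ->
  (u n)^-1 * (Rintegral mu setT (f (u n + c)) - Rintegral mu setT (f c))
    @[n --> \oo] --> fine (\int[mu]_t G t)%E.
  move=> u0' ucv.
  (* The quotient bound needs |u n| at most [e], which holds only eventually; hence the shift by
     [N]. *)
  have [N _ NP] : \forall n \near \oo, `|u n| <= e.
    by move/cvgr0Pnorm_le : ucv; exact.
  have := @seq_cvg (fun n => u (n + N)%N) (fun n => u0' _)
    (fun n => NP _ (leq_addl _ _)).
  rewrite (cvg_shiftn N u) => /(_ ucv).
  by rewrite (cvg_shiftn N (fun n => (u n)^-1 *
    (Rintegral mu setT (f (u n + c)) - Rintegral mu setT (f c)))).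
have lim0 : (h^-1 * (Rintegral mu setT (f (h + c)) - Rintegral mu setT (f c)))
    @[h --> (0 : R)^'] --> fine (\int[mu]_t G t)%E.
  by apply/cvgr_dnbhsP => u [up ucv]; exact: gen.
apply: cvg_trans lim0; apply: near_eq_cvg; near=> h => /=.
by rewrite -[h *: 1]/(h * 1) mulr1.
Unshelve. all: by end_near. Qed.

End DerivIntegral.

(** * Cumulant generating functions *)

Section EReal.
Context (R : realType).

Lemma measurable_expeR : measurable_fun [set: \bar R] (@expeR R).
Proof.
(* [er_map] fixes [-oo], where the exponential is 0; the maximum corrects this value alone. *)
have -> : @expeR R = (fun x => maxe (er_map expR x) 0).
  apply/funext => -[r| |] /=.
  - by rewrite max_l// lee_fin expR_ge0.
  - by rewrite max_l// leey.
  - by rewrite max_r// leNye.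
apply: measurable_maxe; last exact: measurable_cst.
exact: (@measurable_er_map _ (\bar R) R _ (@measurable_expR R)).
Qed.

Lemma measurable_lne : measurable_fun [set: \bar R] (@lne R).
Proof.
have -> : @lne R = (fun x => if (x <= 0)%E then -oo%E else er_map (@ln R) x).
  by apply/funext => -[r| |] /=; rewrite ?lee_fin ?leNye ?leye_eq.
apply: measurable_fun_ifT.
- by apply: measurable_fun_lee; [exact: measurable_id|exact: measurable_cst].
- exact: measurable_cst.
- exact: (@measurable_er_map _ (\bar R) R _ (@measurable_ln R)).
Qed.

Lemma expR_wconvex (u v th : R) : 0 <= th -> th <= 1 ->
  expR (th * u + (1 - th) * v) <= th * expR u + (1 - th) * expR v.
Proof.
move=> t0 t1; have := convex_expR (Itv01 t0 t1) u v.
by rewrite !convRE.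
Qed.

End EReal.

(** * Log-convexity of the moment generating function *)

Section Cgf.
Context d (T : measurableType d) (R : realType) (P : probability T R).

(** [Z] is extended-valued because for [Lambda1] it is a partial integral of [F]. The convention
    that 0 times infinity is 0 makes the value at [c = 0] equal to 1 even so. *)
Definition mgf (Z : T -> \bar R) (c : R) : \bar R :=
  (\int[P]_t expeR (c%:E * Z t))%E.

Definition cgf (Z : T -> \bar R) (c : R) : \bar R := lne (mgf Z c).

Variable Z : T -> \bar R.
Hypothesis mZ : measurable_fun [set: T] Z.

Lemma measurable_expeRZ c : measurable_fun [set: T] (fun t => expeR (c%:E * Z t)%E).
Proof.
apply: (measurableT_comp (@measurable_expeR R)).
exact: measurable_funeM.
Qed.

Lemma mgf_ge0 c : (0 <= mgf Z c)%E.
Proof. by apply: integral_ge0 => t _; exact: expeR_ge0. Qed.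

Lemma expeR_cgf c : expeR (cgf Z c) = mgf Z c.
Proof. by rewrite lneK// in_itv/= mgf_ge0 leey. Qed.

Lemma mgf0 : mgf Z 0 = 1%E.
Proof.
rewrite /mgf; under eq_integral do rewrite mul0e expeR0.
by rewrite integral_cst// mul1e; exact: probability_setT.
Qed.

(* Instead of Hoelder's inequality, integrate the convexity of exp at the
   normalised exponents aZ - x and bZ - y. *)
Lemma mgf_log_convex a b th x y : 0 <= a -> 0 <= b -> 0 < th < 1 ->
  0 < th * a + (1 - th) * b -> mgf Z a = (expR x)%:E -> mgf Z b = (expR y)%:E ->
  (mgf Z (th * a + (1 - th) * b) <= (expR (th * x + (1 - th) * y))%:E)%E.
Proof.
move=> a0 b0 /andP[t0 t1]; set c := th * a + (1 - th) * b => c0 ax bye.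
set w := th * x + (1 - th) * y.
have t1' : 0 < 1 - th by rewrite subr_gt0.
(* The weights arise by factoring [expR w] out of the convexity inequality; they satisfy
   [k * expR x + l * expR y = expR w]. *)
pose k := expR (w - x) * th; pose l := expR (w - y) * (1 - th).
have k0 : 0 < k by rewrite mulr_gt0 ?expR_gt0.
have l0 : 0 < l by rewrite mulr_gt0 ?expR_gt0.
have pw t : (expeR (c%:E * Z t) <=
    k%:E * expeR (a%:E * Z t) + l%:E * expeR (b%:E * Z t))%E.
  case: (Z t) => [z| |].
  - rewrite /= lee_fin.
    have -> : c * z = w + (th * (a * z - x) + (1 - th) * (b * z - y)).
      by rewrite /c /w; ring.
    have -> : k * expR (a * z) + l * expR (b * z) =
        expR w * (th * expR (a * z - x) + (1 - th) * expR (b * z - y)).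
      by rewrite /k /l !expRB; ring.
    by rewrite expRD ler_wpM2l ?expR_ge0// expR_wconvex ?ltW.
  (* At [Z t = +oo] one of [a] and [b] is positive because [c] is, so the right-hand side is [+oo]
     too. *)
  - have [a1|a1] := ltP 0 a.
      rewrite (@gt0_muley _ c%:E) ?(@gt0_muley _ a%:E) ?lte_fin//=.
      rewrite (@gt0_muley _ k%:E) ?lte_fin// addye ?leey//.
      rewrite gt_eqF// (lt_le_trans (@ltNy0 R))//.
      by rewrite mule_ge0 ?lee_fin ?(ltW l0)// expeR_ge0.
    have a1' : a = 0 by apply/le_anti; rewrite a1 a0.
    have b1 : 0 < b by rewrite lt0r b0 andbT; apply: contraTneq c0 => b1;
      rewrite /c a1' b1 !mulr0 addr0 ltxx.
    rewrite (@gt0_muley _ c%:E) ?(@gt0_muley _ b%:E) ?lte_fin//=.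
    rewrite (@gt0_muley _ l%:E) ?lte_fin// addey ?leey//.
    rewrite gt_eqF// (lt_le_trans (@ltNy0 R))//.
    by rewrite mule_ge0 ?lee_fin ?(ltW k0)// expeR_ge0.
  - rewrite (@gt0_muleNy _ c%:E) ?lte_fin// [leLHS]/=.
    by apply: adde_ge0; apply: mule_ge0; rewrite ?expeR_ge0 ?lee_fin ?ltW.
apply: (@le_trans _ _ (\int[P]_t
    (k%:E * expeR (a%:E * Z t) + l%:E * expeR (b%:E * Z t)))%E).
  apply: ge0_le_integral => //.
  - by move=> t _; exact: expeR_ge0.
  - exact: measurable_expeRZ.
  - by apply: emeasurable_funD; apply: measurable_funeM; exact: measurable_expeRZ.
rewrite ge0_integralD//; last 4 first.
- by move=> t _; rewrite mule_ge0 ?lee_fin ?(ltW k0)// expeR_ge0.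
- by apply: measurable_funeM; exact: measurable_expeRZ.
- by move=> t _; rewrite mule_ge0 ?lee_fin ?(ltW l0)// expeR_ge0.
- by apply: measurable_funeM; exact: measurable_expeRZ.
rewrite !ge0_integralZl_EFin//; last 6 first.
- by move=> t _; exact: expeR_ge0.
- exact: measurable_expeRZ.
- exact: ltW.
- by move=> t _; exact: expeR_ge0.
- exact: measurable_expeRZ.
- exact: ltW.
rewrite -/(mgf Z a) -/(mgf Z b) ax bye -!EFinM -EFinD lee_fin.
rewrite le_eqVlt; apply/orP; left; apply/eqP.
by rewrite /k /l !expRB; field; rewrite !gt_eqF ?expR_gt0.
Qed.

Lemma mgf_cgf c x : (mgf Z c = (expR x)%:E) <-> (cgf Z c = x%:E).
Proof.
split=> [H|H]; first by rewrite /cgf H lne_EFin ?expR_gt0// expRK.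
by rewrite -expeR_cgf H.
Qed.

Lemma cgf_convex a b th x y : 0 <= a -> 0 <= b -> 0 < th < 1 ->
  0 < th * a + (1 - th) * b -> cgf Z a = x%:E -> cgf Z b = y%:E ->
  (cgf Z (th * a + (1 - th) * b) <= (th * x + (1 - th) * y)%:E)%E.
Proof.
move=> a0 b0 th01 c0 /mgf_cgf ax /mgf_cgf bye.
rewrite -lee_expeR expeR_cgf; exact: mgf_log_convex.
Qed.

(** The integral vanishes only if [Z = -oo] almost everywhere, a condition free of [s]. *)
Lemma mgf_eq0 a s : 0 < a -> 0 < s -> mgf Z s = 0%E -> mgf Z a = 0%E.
Proof.
move=> a0 s0 Zs.
have /ae_eq_integral_abs : (\int[P]_t `|expeR (s%:E * Z t)| = 0)%E.
  by rewrite -[RHS]Zs; apply: eq_integral => t _; rewrite gee0_abs// expeR_ge0.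
move=> /(_ measurableT (measurable_expeRZ s)) H.
rewrite /mgf (ae_eq_integral (cst 0%E))// ?integral0//; first exact: measurable_expeRZ.
apply: filterS H => t /(_ Logic.I) /eqP /= + _.
rewrite expeR_eq0 => H; apply/eqP; rewrite expeR_eq0.
case: (Z t) H => [//||_]; last by rewrite gt0_muleNy ?lte_fin.
by rewrite gt0_muley ?lte_fin.
Qed.

End Cgf.

(** * Differentiability, monotonicity and left continuity of the cumulant generating function *)

Section CgfRegularity.
Context d (T : measurableType d) (R : realType) (P : probability T R).
Variable Z : T -> \bar R.
Hypothesis mZ : measurable_fun [set: T] Z.

(* For s > 0 this is expeR (s Z) except where Z = +oo, a null set when the
   moment generating function is finite. *)
Let f (s : R) (t : T) : R := if Z t is z%:E then expR (s * z) else 0.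

Let mf s : measurable_fun [set: T] (f s).
Proof.
have -> : f s = fun t => if Z t \is a fin_num then expR (s * fine (Z t)) else 0.
  by apply/funext => t; rewrite /f; case: (Z t).
apply: measurable_fun_ifT.
- by apply: (measurable_fun_bool true); exact: emeasurable_fin_num.
- apply: (measurableT_comp (@measurable_expR R)).
  apply: measurable_funM => //.
  by apply: (measurableT_comp (fine_measurable measurableT)).
- exact: measurable_cst.
Qed.

Let f_le s t : 0 < s -> ((f s t)%:E <= expeR (s%:E * Z t))%E.
Proof.
move=> s0; rewrite /f; case: (Z t) => [z| |] //.
- by rewrite gt0_muley ?lte_fin// leey.
- by rewrite gt0_muleNy ?lte_fin.
Qed.

Let f_ge0 s t : 0 <= f s t.
Proof. by rewrite /f; case: (Z t) => // z; exact: expR_ge0. Qed.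

Let f_int s : 0 < s -> (mgf P Z s < +oo)%E -> P.-integrable [set: T] (EFin \o f s).
Proof.
move=> s0 Zs; have iZ : P.-integrable [set: T] (fun t => expeR (s%:E * Z t)%E).
  apply/integrableP; split; first exact: measurable_expeRZ.
  by under eq_integral do rewrite gee0_abs ?expeR_ge0//.
apply: le_integrable iZ => //; first exact/measurable_EFinP.
move=> t _; rewrite [leRHS]gee0_abs ?expeR_ge0//= ger0_norm//.
exact: f_le.
Qed.

Let f_integral s : 0 < s -> (mgf P Z s < +oo)%E ->
  (\int[P]_t (f s t)%:E = mgf P Z s)%E.
Proof.
move=> s0 Zs; have iZ : P.-integrable [set: T] (fun t => expeR (s%:E * Z t)%E).
  apply/integrableP; split; first exact: measurable_expeRZ.
  by under eq_integral do rewrite gee0_abs ?expeR_ge0//.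
apply: ge0_ae_eq_integral => //.
- exact/measurable_EFinP.
- exact: measurable_expeRZ.
- by move=> t _; rewrite lee_fin.
- by move=> t _; exact: expeR_ge0.
- apply: filterS (integrable_ae measurableT iZ) => t /(_ Logic.I) + _.
  rewrite /f; case: (Z t) => [z //||_].
  + by rewrite gt0_muley ?lte_fin.
  + by rewrite gt0_muleNy ?lte_fin.
Qed.

(** Convexity excludes [+oo]; the value [-oo] at one point would recur at [c - e] by [mgf_eq0]. *)
Lemma cgf_fin_between (c e x y : R) : 0 < e -> 0 < c - e ->
  cgf P Z (c - e) = x%:E -> cgf P Z (c + e) = y%:E ->
  forall s, `|s - c| <= e -> exists z, cgf P Z s = z%:E.
Proof.
move=> e0 ce cx cy s sce.
have [->|se] := eqVneq s (c - e); first by exists x.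
have [->|se'] := eqVneq s (c + e); first by exists y.
move: sce; rewrite ler_distl !le_eqVlt eq_sym (negbTE se) (negbTE se')/=.
move=> /andP[sl sr].
pose th := (c + e - s) / (2 * e).
have th01 : 0 < th < 1.
  apply/andP; split; first by rewrite divr_gt0//; lra.
  by rewrite ltr_pdivrMr; lra.
have sE : s = th * (c - e) + (1 - th) * (c + e).
  by rewrite /th; field; rewrite gt_eqF.
have s0 : 0 < s by lra.
have := cgf_convex mZ (ltW ce) (ltW (lt_trans s0 sr)) th01 _ cx cy.
rewrite -sE => /(_ s0).
case cs : (cgf P Z s) => [z| |] // _; first by exists z.
have : mgf P Z s = 0%E by rewrite -expeR_cgf cs.
by move=> /(mgf_eq0 mZ ce s0) m0; move: cx; rewrite /cgf m0 /= lexx.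
Qed.

(** For each [t], [f s t] is convex in [s], so [derivable_Rintegral] differentiates the moment
    generating function; the chain rule for [ln] does the rest. *)
Lemma derivable_cgf (c e x y : R) : 0 < e -> 0 < c - e ->
  cgf P Z (c - e) = x%:E -> cgf P Z (c + e) = y%:E ->
  derivable (fun s => fine (cgf P Z s)) c 1.
Proof.
move=> e0 ce cx cy.
have fin := cgf_fin_between e0 ce cx cy.
have pos s : `|s - c| <= e -> 0 < s by rewrite ler_distl => /andP[sl _]; lra.
have mfin s : `|s - c| <= e -> (mgf P Z s < +oo)%E.
  by move=> /fin[z]; move/mgf_cgf => ->; rewrite ltry.
pose M s := Rintegral P setT (f s).
have ME s : `|s - c| <= e -> fine (cgf P Z s) = ln (M s) /\ 0 < M s.
  move=> sc; have [z cz] := fin _ sc; rewrite cz /M /Rintegral.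
  rewrite (f_integral (pos _ sc) (mfin _ sc)); move/mgf_cgf : cz => ->.
  by rewrite /= expRK; split => //; exact: expR_gt0.
have dM : derivable M c 1.
  apply: (@derivable_Rintegral _ _ _ _ _ _ e) => //.
  - by move=> r rc; apply: f_int; [exact: pos|exact: mfin].
  - apply: aeW => t; split.
    + move=> a b th _ _ t0 t1; rewrite /f; case: (Z t) => [z| |];
        rewrite ?mulr0 ?addr0//.
      have -> : (th * a + (1 - th) * b) * z = th * (a * z) + (1 - th) * (b * z).
        by ring.
      exact: expR_wconvex.
    + rewrite /f; case: (Z t) => [z| |]; [|exact: derivable_cst..].
      by apply: ex_derive.
have cc : `|c - c| <= e by rewrite subrr normr0 ltW.
have near_c : \forall s \near c, ln (M s) = fine (cgf P Z s).
  exists e => // s /=; rewrite distrC => /ltW sc.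
  by case: (ME _ sc).
apply: (near_eq_derivable near_c).
have [_ Mc] := ME _ cc.
have Dln := is_derive1_ln Mc.
have DM := derivableP dM.
by case: (is_derive1_comp Dln DM).
Qed.


Hypothesis Z0 : forall t, (0 <= Z t)%E.

(** This is the equality case of the Cauchy-Schwarz inequality for [exp(aZ/2)] and [exp(bZ/2)]: it
    makes [Z] almost surely constant, hence [cgf] linear in [c]. *)
Lemma cgf_midpoint_eq (a b x y : R) : 0 < a -> a < b ->
  cgf P Z a = x%:E -> cgf P Z b = y%:E ->
  cgf P Z ((a + b) / 2) = ((x + y) / 2)%:E -> b * x = a * y.
Proof.
move=> a0 ab /mgf_cgf ax /mgf_cgf bye /mgf_cgf mE; set m := (a + b) / 2 in mE.
have b0 : 0 < b := lt_trans a0 ab.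
have m0 : 0 < m by rewrite divr_gt0// addr_gt0.
have ia : P.-integrable setT (EFin \o f a) by apply: f_int => //; rewrite ax ltry.
have ib : P.-integrable setT (EFin \o f b) by apply: f_int => //; rewrite bye ltry.
have im : P.-integrable setT (EFin \o f m) by apply: f_int => //; rewrite mE ltry.
pose g t := ((expR (- x))%:E * (f a t)%:E + (expR (- y))%:E * (f b t)%:E
   - (2 * expR (- ((x + y) / 2)))%:E * (f m t)%:E)%E.
(* The integral of g vanishes, and g is a square. *)
have gE t : (g t = if Z t is z%:E then
    ((expR ((a * z - x) / 2) - expR ((b * z - y) / 2)) ^+ 2)%:E else 0)%E.
  rewrite /g /f; case: (Z t) => [z| |]; rewrite ?mule0 ?addr0 ?sube0//.
  rewrite -!EFinM -EFinD; congr _%:E.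
  rewrite -!expRD -(mulrA 2) -expRD sqrrB -!expRM_natl -expRD.
  have -> : - x + a * z = 2 * ((a * z - x) / 2) by field.
  have -> : - y + b * z = 2 * ((b * z - y) / 2) by field.
  have -> : - ((x + y) / 2) + m * z = (a * z - x) / 2 + (b * z - y) / 2.
    by rewrite /m; field.
  by ring.
have g0 t : (0 <= g t)%E.
  by rewrite gE; case: (Z t) => [z||]//; rewrite lee_fin sqr_ge0.
have iga := integrableZl measurableT (expR (- x)) ia.
have igb := integrableZl measurableT (expR (- y)) ib.
have igm := integrableZl measurableT (2 * expR (- ((x + y) / 2))) im.
have int_g : (\int[P]_t g t = 0)%E.
  rewrite integralB//; last exact: integrableD.
  rewrite integralD// !integralZl//= !f_integral//; last 3 first.
    by rewrite mE ltry.
    by rewrite bye ltry.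
    by rewrite ax ltry.
  rewrite ax bye mE -!EFinM -EFinD -mulrA -!expRD !addNr expR0.
  by congr _%:E; ring.
have mg : measurable_fun setT g.
  exact: measurable_int (integrableB measurableT (integrableD measurableT iga igb) igm).
have /ae_eq_integral_abs : (\int[P]_t `|g t| = 0)%E.
  by rewrite -[RHS]int_g; apply: eq_integral => t _; rewrite gee0_abs.
move=> /(_ measurableT mg) ae_g.
have iZ : P.-integrable [set: T] (fun t => expeR (a%:E * Z t)%E).
  apply/integrableP; split; first exact: measurable_expeRZ.
  by under eq_integral do rewrite gee0_abs ?expeR_ge0//; rewrite -/(mgf P Z a) ax ltry.
(* Where the square vanishes, [a * z - x = b * z - y]. Finiteness of [mgf P Z a] excludes [+oo], and
   [Z0] excludes [-oo]. *)
have ae_Z : {ae P, forall t, Z t = ((y - x) / (b - a))%:E}.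
  apply: filterS2 (integrable_ae measurableT iZ) ae_g => t /(_ Logic.I) + /(_ Logic.I).
  move=> fin; rewrite gE => /=; move: fin (Z0 t); case: (Z t) => [z _ _||//]; last first.
    by rewrite gt0_muley ?lte_fin.
  move=> [] /eqP; rewrite sqrf_eq0 subr_eq0 => /eqP /expR_inj H.
  have -> : y - x = z * (b - a) by lra.
  by rewrite mulfK// subr_eq0 gt_eqF.
have mgfk c : mgf P Z c = (expR (c * ((y - x) / (b - a))))%:E.
  rewrite /mgf (ae_eq_integral (cst (expR (c * ((y - x) / (b - a))))%:E))//.
  - by rewrite integral_cst// [X in (_ * X)%E]probability_setT mule1.
  - exact: measurable_expeRZ.
  - by apply: filterS ae_Z => t -> _.
move: ax; rewrite mgfk mulrA => -[/expR_inj ax].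
have : a * (y - x) = x * (b - a) by rewrite -[in RHS]ax divfK// subr_eq0 gt_eqF.
by lra.
Qed.

Lemma mgf_ge1 c : 0 <= c -> (1 <= mgf P Z c)%E.
Proof.
move=> c0; rewrite -(mgf0 P Z) /mgf; apply: ge0_le_integral => //.
- by move=> t _; exact: expeR_ge0.
- exact: measurable_expeRZ.
- exact: measurable_expeRZ.
- by move=> t _; rewrite lee_expeR mul0e mule_ge0.
Qed.

Lemma cgf_ge0 c : 0 <= c -> (0 <= cgf P Z c)%E.
Proof. by move=> c0; rewrite lne_ge0 mgf_ge1. Qed.

Lemma cgf_nondecreasing a b : a <= b -> (cgf P Z a <= cgf P Z b)%E.
Proof.
move=> ab; rewrite -lee_expeR !expeR_cgf; apply: ge0_le_integral => //.
- by move=> t _; exact: expeR_ge0.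
- exact: measurable_expeRZ.
- exact: measurable_expeRZ.
- by move=> t _; rewrite lee_expeR lee_wpmul2r.
Qed.

(** Convexity on [[0, b]] with value 0 at 0, where [a] carries weight [a / b] on the endpoint
    [b]. *)
Lemma cgf_div_nondecreasing a b : 0 < a -> a <= b ->
  (a^-1%:E * cgf P Z a <= b^-1%:E * cgf P Z b)%E.
Proof.
move=> a0; rewrite le_eqVlt => /predU1P[<-//|ab].
have b0 := lt_trans a0 ab.
have := cgf_ge0 (ltW b0); case bE : (cgf P Z b) => [y| |]// _; last first.
  by rewrite gt0_muley ?leey// lte_fin invr_gt0.
have th01 : 0 < a / b < 1 by rewrite divr_gt0//= ltr_pdivrMr// mul1r.
have c0 : cgf P Z 0 = 0%:E by rewrite /cgf mgf0 lne1.
have := cgf_convex mZ (ltW b0) (lexx 0) th01 _ bE c0.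
rewrite !mulr0 !addr0 divfK ?gt_eqF// => /(_ a0) H.
apply: (@le_trans _ _ (a^-1%:E * (a / b * y)%:E)%E).
  by rewrite lee_wpmul2l// lee_fin invr_ge0 ltW.
by rewrite -!EFinM lee_fin !mulrA mulVf ?gt_eqF// mul1r.
Qed.

(** Monotone convergence: [exp(u_n Z)] increases to [exp(c Z)]. The inequality is compared after
    exponentiating, so that continuity of [lne] does not enter. *)
Lemma cgf_limn (u : nat -> R) c : nondecreasing_seq u -> (forall n, 0 < u n) ->
  u n @[n --> \oo] --> c -> cgf P Z c = limn (fun n => cgf P Z (u n)).
Proof.
move=> nd u0 uc.
have uc_le n : u n <= c.
  by rewrite -(cvg_lim _ uc)//; apply: nondecreasing_cvgn_le => //; apply: cvgP uc.
have cnd : nondecreasing_seq (fun n => cgf P Z (u n)).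
  by move=> n m nm; exact/cgf_nondecreasing/nd.
have cvg_c := ereal_nondecreasing_is_cvgn cnd.
apply/le_anti/andP; split; last first.
  by apply: lime_le => //; apply: nearW => n; exact: cgf_nondecreasing.
rewrite -lee_expeR expeR_cgf.
have -> : mgf P Z c = (\int[P]_t limn (fun n => expeR ((u n)%:E * Z t)))%E.
  apply: eq_integral => t _; apply/esym/cvg_lim => //.
  move: (Z0 t); case: (Z t) => [z _| _|//].
  - apply: cvg_EFin; first exact: nearW.
    have uz : u n * z @[n --> \oo] --> c * z by apply: cvgM => //; exact: cvg_cst.
    exact: (continuous_cvg _ (@continuous_expR R (c * z)) uz).
  - under eq_fun do rewrite gt0_muley ?lte_fin//.
    rewrite gt0_muley ?lte_fin//; first exact: cvg_cst.
    exact: lt_le_trans (u0 0%N) (uc_le 0%N).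
have := @cvg_monotone_convergence _ _ _ P setT measurableT
  (fun n t => expeR ((u n)%:E * Z t)%E).
move=> /(_ (fun n => measurable_expeRZ mZ (u n))) /(_ (fun n t _ => expeR_ge0 _)).
move=> /(_ _)/cvg_lim <-//; last first.
  by move=> t _ n m nm; rewrite lee_expeR lee_wpmul2r// lee_fin nd.
apply: lime_le.
  apply: ereal_nondecreasing_is_cvgn => n m nm; apply: ge0_le_integral => //.
  - by move=> t _; exact: expeR_ge0.
  - exact: measurable_expeRZ.
  - exact: measurable_expeRZ.
  - by move=> t _; rewrite lee_expeR lee_wpmul2r// lee_fin nd.
apply: nearW => n; rewrite -/(mgf P Z (u n)) -expeR_cgf lee_expeR.
by apply: lime_ge => //; exists n => // m nm; exact: cnd.
Qed.

End CgfRegularity.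

(** * Local minima of the objective *)

Section LocalMin.
Context (R : realType) (L : R -> \bar R) (B : R).
Hypothesis B0 : 0 < B.
Hypothesis L0 : forall c, 0 < c -> (0 <= L c)%E.
Hypothesis L_nd : forall a b, 0 < a -> a <= b -> (L a <= L b)%E.

Let L_fin c (y : R) : 0 < c -> (objective L B c <= y%:E)%E ->
  exists2 x, L c = x%:E & B / c + x <= y.
Proof.
move=> c0; rewrite /objective mulrC; move: (L0 c0); case: (L c) => [x _| |]//.
by rewrite -EFinD lee_fin; exists x.
Qed.

Lemma le_lim_pinfty l t : L s @[s --> +oo] --> l -> 0 < t -> (L t <= l)%E.
Proof.
move=> cl t0; rewrite -(cvg_lim _ cl)//. apply: lime_ge; first exact: cvgP cl.
near=> s; apply: (L_nd t0).
by near: s; apply: nbhs_pinfty_ge; rewrite num_real.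
Unshelve. all: by end_near. Qed.

(** * Uniqueness of the minimum from convexity of [c * L c] *)

Section Convex.
Hypothesis L_cvx : forall a b th x y, 0 < a -> 0 < b -> 0 < th < 1 ->
  L a = x%:E -> L b = y%:E ->
  ((th * a + (1 - th) * b)%:E * L (th * a + (1 - th) * b) <=
    (th * (a * x) + (1 - th) * (b * y))%:E)%E.

(** Multiplied by its argument [s], the objective becomes the convex [B + s * L s], and the level
    [q] at [r] becomes the linear [s * q]. A point [t] below this level would force points
    arbitrarily close to [r] below it. *)
Lemma local_min_global r : local_min_at L B r%:E ->
  forall t, 0 < t -> (objective L B r <= objective L B t)%E.
Proof.
move=> [r0 fin_r min_r] t t0; rewrite leNgt; apply/negP => tr.
have [x Lr _] : exists2 x, L r = x%:E & B / r + x <= fine (objective L B r).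
  apply: L_fin => //; rewrite fineK// ge0_fin_numE// adde_ge0 ?L0//.
  by rewrite lee_fin mulr_ge0 ?invr_ge0 ?ltW.
have orE : objective L B r = (B / r + x)%:E by rewrite /objective Lr mulrC.
have otr : (objective L B t <= (B / r + x)%:E)%E by rewrite -orE ltW.
have [y Lt _] := L_fin t0 otr.
move: tr; rewrite orE /objective Lt -EFinD lte_fin => tr.
case: min_r => e /= e0 min_r.
(* This weight puts [s] at distance [th] times |t - r| from [r], which is less than [e]. *)
pose th := e / (2 * (e + `|t - r|)).
have d0 : 0 <= `|t - r| by [].
have D0 : 0 < 2 * (e + `|t - r|) by lra.
have th0 : 0 < th by rewrite divr_gt0.
have th1 : th < 1 by rewrite ltr_pdivrMr//; lra.
have th01 : 0 < th < 1 by rewrite th0.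
have := L_cvx t0 r0 th01 Lt Lr; set s := th * t + (1 - th) * r.
have s0 : 0 < s by apply: addr_gt0; apply: mulr_gt0 => //; rewrite subr_gt0.
have sr : `|r - s| < e.
  have -> : r - s = th * (r - t) by rewrite /s; ring.
  rewrite normrM gtr0_norm// distrC /th mulrAC ltr_pdivrMr// ltr_pM2l//; lra.
have := min_r s sr s0; rewrite orE /objective.
move: (L0 s0); case: (L s) => [z _| _ _|//].
  rewrite -EFinD !lee_fin => A1 A2.
  have {}A1 : s * (B / r + x) <= B + s * z.
    have -> : B + s * z = s * (s^-1 * B + z) by field; rewrite gt_eqF.
    by rewrite ler_pM2l.
  have {}tr : B + t * y < t * (B / r + x).
    have -> : B + t * y = t * (t^-1 * B + y) by field; rewrite gt_eqF.
    by rewrite ltr_pM2l.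
  have rr : B + r * x = r * (B / r + x) by field; rewrite gt_eqF.
  move: A1 tr rr; set q := B / r + x => A1 tr rr.
  have sq : s * q = th * (t * q) + (1 - th) * (r * q) by rewrite /s; ring.
  have T1 : th * (B + t * y) < th * (t * q) by rewrite ltr_pM2l.
  have R1 : (1 - th) * (B + r * x) = (1 - th) * (r * q) by rewrite rr.
  clearbody q s th; lra.
by rewrite gt0_muley ?lte_fin// leye_eq.
Qed.

Hypothesis L_strict : forall a b x y, 0 < a -> a < b ->
  L a = x%:E -> L b = y%:E ->
  (((a + b) / 2)%:E * L ((a + b) / 2) = ((a * x + b * y) / 2)%:E)%E -> x = y.

(** Both points are global minima with a common value [q], so [B + c * L c] equals [c * q] at both.
    Convexity from above and minimality from below give equality at the midpoint; [L_strict] then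
    leaves [B / a = B / b]. *)
Lemma local_min_real_unique a b :
  local_min_at L B a%:E -> local_min_at L B b%:E -> a = b.
Proof.
wlog ab : a b / a < b.
  move=> H; have [|ab ma mb|] := ltgtP a b; [exact: H| |by []].
  by apply/esym; exact: H.
move=> ma mb; exfalso.
have a0 : 0 < a by case: ma.
have b0 : 0 < b by case: mb.
have ga := local_min_global ma; have gb := local_min_global mb.
have fin c : 0 < c -> local_min_at L B c%:E -> exists x, L c = x%:E.
  move=> c0 [_ oc _].
  case: (L_fin c0 (y := fine (objective L B c))) => [|x]; last by exists x.
  rewrite fineK// ge0_fin_numE// adde_ge0 ?L0//.
  by rewrite lee_fin mulr_ge0 ?invr_ge0 ?ltW.
have [x La] := fin _ a0 ma; have [y Lb] := fin _ b0 mb.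
have oab : a^-1 * B + x = b^-1 * B + y.
  apply/le_anti; have := ga _ b0; have := gb _ a0.
  by rewrite /objective La Lb -!EFinD !lee_fin => -> ->.
have h01 : 0 < (2^-1 : R) < 1 by apply/andP; split; lra.
have := L_cvx a0 b0 h01 La Lb.
have -> : 2^-1 * a + (1 - 2^-1) * b = (a + b) / 2 by field.
set m := (a + b) / 2; have m0 : 0 < m by rewrite /m; lra.
have -> : 2^-1 * (a * x) + (1 - 2^-1) * (b * y) = (a * x + b * y) / 2 by field.
have := ga _ m0; rewrite /objective La => gm cm.
have eqm : (m%:E * L m = ((a * x + b * y) / 2)%:E)%E.
  apply/le_anti; rewrite cm/=; move: cm gm (L0 m0).
  case: (L m) => [z| |]//; last by move=> _ _ _; rewrite gt0_muley ?lte_fin// leey.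
  rewrite -!EFinD !lee_fin => _ gm _.
  have : m * (a^-1 * B + x) <= B + m * z.
    have -> : B + m * z = m * (m^-1 * B + z) by field; rewrite gt_eqF.
    by rewrite ler_pM2l.
  have ea : B + a * x = a * (a^-1 * B + x) by field; rewrite gt_eqF.
  have eb : B + b * y = b * (b^-1 * B + y) by field; rewrite gt_eqF.
  rewrite -oab in eb; set q := a^-1 * B + x in ea eb *.
  have -> : m * q = (a * q + b * q) / 2 by rewrite /m; field.
  by clearbody q m; lra.
have xy := L_strict a0 ab La Lb eqm.
move: oab; rewrite xy => /addIr /(mulIf (negbT (gt_eqF B0))) /invr_inj ab'.
by move: ab; rewrite ab' ltxx.
Qed.

Lemma local_min_pinfty_unique a :
  local_min_at L B a%:E -> ~ local_min_at L B +oo%E.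
Proof.
move=> ma [cv lt_lim]; have a0 : 0 < a by case: ma.
have ga := local_min_global ma.
have oa : (objective L B a < +oo)%E by case: ma.
have := lt_lim _ a0.
have l0 : (0 <= lim (L s @[s --> +oo%R]))%E.
  by apply: le_trans (L0 a0) _; apply: le_lim_pinfty.
have le_l t : 0 < t -> (L t <= lim (L s @[s --> +oo%R]))%E by exact: le_lim_pinfty.
case: (lim _) l0 le_l => [l| |//] l0 le_l; last by rewrite ltNge leey.
move: oa ga; case: (objective L B a) => [v| |] // _ ga; rewrite lte_fin => lv.
(* Then [B / t] is half the gap [v - l], so the objective at [t] falls below the global minimum
   [v]. *)
pose t := 2 * B / (v - l).
have vl : 0 < v - l by rewrite subr_gt0.
have t0 : 0 < t by rewrite divr_gt0// mulr_gt0.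
have := ga _ t0; rewrite leNgt => /negP; apply.
rewrite /objective; apply: (@le_lt_trans _ _ ((t^-1 * B)%:E + l%:E)%E).
  by rewrite leeD2l// le_l.
rewrite -EFinD lte_fin.
have -> : t^-1 * B = (v - l) / 2 by rewrite /t; field; rewrite !gt_eqF.
by lra.
Qed.
End Convex.

(** * Existence of the minimum from lower semicontinuity and compactness *)

Hypothesis L_lsc : forall c r, 0 < c -> (r%:E < L c)%E ->
  exists2 c', 0 < c' < c & (r%:E < L c')%E.
Hypothesis L_fin_ex : exists2 c, 0 < c & (L c < +oo)%E.

(** To the right of the point [c'] given by [L_lsc], monotonicity keeps [L t] at least [L c'], and
    [B / t] is continuous. This is lower semicontinuity of the objective. *)
Let objective_near c (r : R) : 0 < c -> (r%:E < objective L B c)%E ->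
  \forall t \near c, (r%:E < objective L B t)%E.
Proof.
move=> c0 rc.
have [r' rr' r'c] : exists2 r', r < r' & (r'%:E < objective L B c)%E.
  case: (objective L B c) rc => [v| |//].
  - rewrite lte_fin => rv; exists ((r + v) / 2); rewrite ?lte_fin; lra.
  - by move=> _; exists (r + 1); [rewrite ltrDl|rewrite ltry].
have : ((r' - c^-1 * B)%:E < L c)%E.
  move: r'c; rewrite /objective; case: (L c) => [v| |]//.
  - by rewrite -EFinD !lte_fin => ?; lra.
  - by move=> _; rewrite ltry.
move=> /(L_lsc c0)[c' /andP[c'0 c'c] Lc'].
have inv_cvg : t^-1 * B @[t --> c] --> c^-1 * B.
  by apply: cvgMl; apply: cvgV => //; rewrite gt_eqF.
near=> t.
have tc' : c' < t by near: t; exact: lt_nbhsr.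
have tB : c^-1 * B - (r' - r) < t^-1 * B.
  near: t; move/cvgr_gt : inv_cvg; apply.
  by rewrite ltrBlDr ltrDl subr_gt0.
have := lt_le_trans Lc' (L_nd c'0 (ltW tc')).
rewrite /objective; case: (L t) => [v| |]//.
- by rewrite -EFinD !lte_fin => ?; lra.
- by rewrite addey ?ltry.
Unshelve. all: by end_near. Qed.

Lemma exists_local_min : exists c, (0 < c)%E /\ local_min_at L B c.
Proof.
pose m := ereal_inf (objective L B @` [set c | 0 < c]).
have obj_ge0 c : 0 < c -> (0 <= objective L B c)%E.
  by move=> c0; rewrite adde_ge0 ?L0// lee_fin mulr_ge0 ?invr_ge0 ?ltW.
have m_le c : 0 < c -> (m <= objective L B c)%E.
  by move=> c0; apply: ereal_inf_lbound; exists c.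
have m0 : (0 <= m)%E by apply: le_ereal_inf_tmp => _ [c /= c0 <-]; exact: obj_ge0.
have moo : (m < +oo)%E.
  have [c c0 Lc] := L_fin_ex; apply: (le_lt_trans (m_le _ c0)).
  by rewrite lte_add_pinfty// ltry.
have m_max k : (forall c, 0 < c -> (k <= objective L B c)%E) -> (k <= m)%E.
  by move=> H; apply: le_ereal_inf_tmp => _ [c /= c0 <-]; exact: H.
clearbody m; case: m m0 moo m_le m_max => [m| |]// m0 _ m_le m_max.
have [[c c0 cm]|nmin] := pselect (exists2 c, 0 < c & objective L B c = m%:E).
  exists c%:E; split; first by rewrite lte_fin.
  split => //; first by rewrite cm ltry.
  by near=> t => t0; rewrite cm; exact: m_le.
have m_lt c : 0 < c -> (m%:E < objective L B c)%E.
  move=> c0; rewrite lt_neqAle m_le// andbT; apply/negP => /eqP mc.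
  by apply: nmin; exists c.
have L_le_m M : 0 < M -> (L M <= m%:E)%E.
  move=> M0; rewrite leNgt; apply/negP => mM.
  rewrite lee_fin in m0.
  (* Left of [e] the term [B / c] exceeds [m + 1], so values near [m] cannot occur there. *)
  pose e := B / (m + 1).
  have e0 : 0 < e by rewrite divr_gt0// ltr_wpDl.
  (* Each point of the segment has a neighbourhood on which the objective stays above some bound
     exceeding [m]; compactness gives a common bound. *)
  have := @segment_compact R e M; move/compact_near_coveringP.
  move=> /(_ R m^'+ (fun i c => i%:E < objective L B c)%E _).
  have H : forall x, `[e, M]%classic x ->
      \forall x' \near x & i \near m^'+, (i%:E < objective L B x')%E.
    move=> x /=; rewrite in_itv/= => /andP[ex _].
    have x0 : 0 < x := lt_le_trans e0 ex.
    have [r mr rx] : exists2 r, m < r & (r%:E < objective L B x)%E.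
      have := m_lt _ x0; case: (objective L B x) => [v| |//].
      - rewrite lte_fin => rv; exists ((m + v) / 2); rewrite ?lte_fin; lra.
      - by move=> _; exists (m + 1); [rewrite ltrDl|rewrite ltry].
    exists ([set t | r%:E < objective L B t]%E, [set i | i < r]).
      by split; [exact: objective_near|exact: nbhs_right_lt].
    move=> [t i] /= [rt ir]; apply: lt_trans rt; rewrite lte_fin.
    exact: ir.
  move=> /(_ H) K.
  have [k mk kL] : exists2 k, m < k & (k%:E < L M)%E.
    case: (L M) mM => [v| |//].
    - rewrite lte_fin => rv; exists ((m + v) / 2); rewrite ?lte_fin; lra.
    - by move=> _; exists (m + 1); [rewrite ltrDl|rewrite ltry].
  (* For [i] slightly above [m], the objective is at least [i] left of [e], on [[e, M]] and beyond
     [M], so [i] would be a lower bound exceeding the infimum. *)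
  have : \forall i \near m^'+, False.
    near=> i.
    have mi : m < i by near: i; exact: nbhs_right_gt.
    have ik : i <= k by near: i; exact: nbhs_right_le.
    have i1 : i <= m + 1 by near: i; apply: nbhs_right_le; rewrite ltrDl.
    have Ki : `[e, M]%classic `<=` (fun c => i%:E < objective L B c)%E by near: i.
    suff : (i%:E <= m%:E)%E by rewrite lee_fin leNgt mi.
    apply: m_max => c c0; have [ce|ec] := ltP c e.
      apply: (@le_trans _ _ (c^-1 * B)%:E); last by rewrite leeDl// L0.
      rewrite lee_fin (le_trans i1)// mulrC ler_pdivlMr//.
      by move: ce; rewrite /e ltr_pdivlMr ?ltr_wpDl// mulrC => /ltW.
    have [cM|Mc] := leP c M.
      by apply/ltW/Ki; rewrite /= in_itv/= ec.
    apply: (@le_trans _ _ (L c)); last by rewrite leeDr// lee_fin mulr_ge0 ?invr_ge0 ?ltW.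
    apply: (@le_trans _ _ k%:E); first by rewrite lee_fin.
    by apply: (le_trans (ltW kL)); apply: L_nd => //; exact: ltW.
  by move=> /filter_ex[].
have cvL : cvg (L t @[t --> +oo]).
  (* The maximum with 1 gives a function that is nondecreasing on the whole line and agrees with [L]
     for large [t]. *)
  have nd : nondecreasing_fun (fun t => L (Num.max t 1)).
    move=> s t st; apply: L_nd; first by rewrite lt_max ltr01 orbT.
    by rewrite ge_max !le_max st lexx orbT.
  apply/cvg_ex; exists (ereal_sup (range (fun t => L (Num.max t 1)))).
  apply: cvg_trans (nondecreasing_cvge nd); apply: near_eq_cvg; near=> t.
  by congr L; apply/max_idPl; near: t; apply: nbhs_pinfty_ge; rewrite num_real.
exists +oo%E; split; first exact: ltry.
split => // t t0; apply: le_lt_trans (m_lt _ t0); apply: lime_le => //.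
near=> s; apply: L_le_m.
by near: s; apply: nbhs_pinfty_gt; rewrite num_real.
Unshelve. all: by end_near. Qed.

End LocalMin.

(** * The Borel sets of a product of Polish spaces *)

Section BorelProduct.
Context (R : realType).

(** The base consists of the balls of radius [1 / (n + 1)] about the points of a countable dense
    set, enumerated by [pickle]; a number coding no pair gives the whole space. *)
Lemma polish_countable_base (T : ptopologicalType) : polish R T ->
  exists2 b : nat -> set T, forall n, open (b n) &
    forall x A, nbhs x A -> exists2 n, b n x & b n `<=` A.
Proof.
move=> [[S cS dS] [d [[d0 dxx dC dtri] nbhsd _]]].
have /countable_injP[f finj] := cS.
(* [e] inverts the injection [f] on [S]; indices outside its image get the arbitrary [point]. *)
have [e eS] : exists e : nat -> T, forall s, S s -> e (f s) = s.
  have /choice[e eP] : forall i, exists t : T, forall s, S s -> f s = i -> t = s.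
    move=> i; have [[t [St ti]]|nt] := pselect (exists t, S t /\ f t = i).
      by exists t => s Ss si; apply: finj; rewrite ?inE// ti si.
    by exists point => s Ss si; exfalso; apply: nt; exists s.
  by exists e => s Ss; exact: eP.
pose ball s n := [set y | d s y < n.+1%:R^-1].
have oball s n : open (ball s n).
  rewrite openE => y /= sy; apply/nbhsd; exists (n.+1%:R^-1 - d s y).
    by rewrite subr_gt0.
  move=> z /= yz; apply: le_lt_trans (dtri s y z) _.
  by rewrite -ltrBrDl.
pose b n := if (unpickle n : option (nat * nat)) is Some (i, k)
  then ball (e i) k else setT.
exists b.
  by move=> n; rewrite /b; case: unpickle => [[i k]|]; [exact: oball|exact: openT].
move=> x A /nbhsd[r r0 rA].
have [n nr] : exists n, n.+1%:R^-1 < r / 2.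
  have [N _ NP] := near_infty_natSinv_lt (PosNum (divr_gt0 r0 (ltr0Sn R 1))).
  by exists N; apply: (NP N) => /=.
have [s [xs Ss]] : (ball x n `&` S) !=set0.
  apply: dS; last exact: oball.
  by exists x; rewrite /ball /= (dxx x x).2// invr_gt0.
exists (pickle (f s, n)); rewrite /b pickleK eS//.
  by rewrite /ball /= dC.
move=> y sy; apply: rA => /=; apply: le_lt_trans (dtri x s y) _.
by rewrite (splitr r) ltrD// (lt_trans _ nr)// dC.
Qed.

(** An open set of the product is the countable union of the base rectangles inside it, and these
    rectangles are measurable. *)
Lemma measurable_borel_prod (X Y : ptopologicalType) (A : set (X * Y)) :
  polish R X -> polish R Y ->
  measurable (A : set (borel (X * Y)%type)) ->
  measurable (A : set (borel X * borel Y)%type).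
Proof.
move=> /polish_countable_base[bX oX baseX] /polish_countable_base[bY oY baseY].
apply: smallest_sub; first exact: sigma_algebra_measurable.
move=> U oU.
have -> : U = \bigcup_n \bigcup_(m in [set m | bX n `*` bY m `<=` U]) (bX n `*` bY m).
  apply/seteqP; split; last by move=> p [n _ [m /= sub]]; exact: sub.
  move=> [x y] Uxy; move: oU; rewrite openE => /(_ _ Uxy)[[V W] /= [xV yW] VW].
  have [n nx nV] := baseX _ _ xV; have [m my mW] := baseY _ _ yW.
  exists n => //; exists m => //= -[u v] [/= un vm]; apply: VW; split => /=.
    exact: nV.
  exact: mW.
apply: bigcupT_measurable => n; apply: bigcup_measurable => m _.
by apply: measurableX; apply: sub_sigma_algebra.
Qed.

Lemma measurable_fun_borel_prod (X Y : ptopologicalType) (F : X * Y -> R) :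
  polish R X -> polish R Y ->
  measurable_fun [set: borel (X * Y)%type] (F : borel (X * Y)%type -> R) ->
  measurable_fun [set: (borel X * borel Y)%type] (F : (borel X * borel Y)%type -> R).
Proof.
move=> pX pY mF _ B mB; apply: measurable_borel_prod => //.
exact: mF.
Qed.

End BorelProduct.

(** * Averages of cumulant generating functions *)

Section Mixture.
Context dX dT (X : measurableType dX) (T : measurableType dT) (R : realType).
Variables (mu : probability X R) (P : probability T R) (Z : X -> T -> \bar R).
Hypothesis mZ : forall x, measurable_fun [set: T] (Z x).
Hypothesis mK : forall c, 0 < c ->
  measurable_fun [set: X] (fun x => cgf P (Z x) c).

Let K c x := cgf P (Z x) c.
Let f c x := fine (K c x).

Definition mixture_cgf c : \bar R := (\int[mu]_x cgf P (Z x) c)%E.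
Let H := mixture_cgf.

Variable L : R -> \bar R.
Hypothesis LE : forall c, 0 < c -> L c = (c^-1%:E * mixture_cgf c)%E.

Let HE c : 0 < c -> H c = (c%:E * L c)%E.
Proof.
by move=> c0; rewrite LE// muleA -EFinM divff ?gt_eqF// mul1e.
Qed.

(** The integral is the difference of the integrals of the positive and negative parts, so a finite
    value makes both finite. *)
Let K_int c : 0 < c -> (-oo < L c)%E -> (L c < +oo)%E -> mu.-integrable setT (K c).
Proof.
move=> c0 Ly Loo.
have : H c \is a fin_num by rewrite HE// fin_numM// fin_numElt Ly.
rewrite /H /mixture_cgf integralE fin_numB => /andP[Kp Kn].
apply/integrableP; split; first exact: mK.
rewrite -[X in integral _ _ X]/(abse \o K c) fune_abse.
rewrite ge0_integralD//; last 2 first.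
- exact/measurable_funepos/mK.
- exact/measurable_funeneg/mK.
by rewrite lte_add_pinfty// ltey_eq ?Kp ?Kn.
Qed.

Let f_int c : mu.-integrable setT (K c) -> mu.-integrable setT (EFin \o f c).
Proof.
move=> iK; apply: le_integrable (iK) => //.
  apply/measurable_EFinP; apply: (measurableT_comp (fine_measurable measurableT)).
  exact: measurable_int iK.
by move=> x _ /=; rewrite /f; case: (K c x) => [k| |] //=; rewrite normr0 leey.
Qed.

Let H_f c : mu.-integrable setT (K c) -> H c = (\int[mu]_x (f c x)%:E)%E.
Proof.
move=> iK; apply: ae_eq_integral => //; first exact: measurable_int iK.
  exact: measurable_int (f_int iK).
by apply: filterS (integrable_ae measurableT iK) => x /(_ Logic.I) + _; move/fineK.
Qed.

Lemma derivable_mixture c : (forall c, 0 < c -> (-oo < L c)%E) ->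
  (finite_domain L)° c -> derivable (fun t => fine (L t)) c 1.
Proof.
move=> Ly [e /= e0 De].
have e2 : 0 < e / 2 by rewrite divr_gt0.
have De' s : `|s - c| <= e / 2 -> 0 < s /\ (L s < +oo)%E.
  move=> sc; apply: De => /=; rewrite distrC.
  by apply: le_lt_trans sc _; rewrite ltr_pdivrMr// ltr_pMr// ltr1n.
have cr : `|(c + e / 2) - c| <= e / 2 by rewrite addrC addKr gtr0_norm.
have cl : `|(c - e / 2) - c| <= e / 2 by rewrite addrC addKr normrN gtr0_norm.
have cc : `|c - c| <= e / 2 by rewrite subrr normr0 ltW.
have iK s : `|s - c| <= e / 2 -> mu.-integrable setT (K s).
  by move=> /De'[s0 Ls]; apply: K_int => //; exact: Ly.
have dR : derivable (fun s => Rintegral mu setT (f s)) c 1.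
  apply: (@derivable_Rintegral _ _ _ _ _ _ (e / 2)) => //.
    by move=> s sc; exact/f_int/iK.
  (* One null set serves all [s]: finiteness at [c - e / 2] and [c + e / 2] passes to the points
     between. *)
  apply: filterS2 (integrable_ae measurableT (iK _ cl))
    (integrable_ae measurableT (iK _ cr)) => x /(_ Logic.I) + /(_ Logic.I).
  move=> /fineK/esym fl /fineK/esym fr.
  have [cl0 _] := De' _ cl.
  have fin := cgf_fin_between (mZ x) e2 cl0 fl fr.
  have D := derivable_cgf (mZ x) e2 cl0 fl fr.
  split; last exact: D.
  move=> a b th ac bc; rewrite !le_eqVlt => /predU1P[<-|t0].
    by rewrite !mul0r !subr0 !mul1r !add0r eqxx.
  move=> /predU1P[->|t1]; first by rewrite !mul1r subrr !mul0r !addr0 eqxx.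
  rewrite -le_eqVlt; have [a0 _] := De' _ ac; have [b0 _] := De' _ bc.
  have th01 : 0 < th < 1 by rewrite t0.
  have [y Ka] := fin _ ac; have [z Kb] := fin _ bc.
  have c0 : 0 < th * a + (1 - th) * b.
    by apply: addr_gt0; apply: mulr_gt0 => //; rewrite subr_gt0.
  have mid : `|th * a + (1 - th) * b - c| <= e / 2.
    have -> : th * a + (1 - th) * b - c = th * (a - c) + (1 - th) * (b - c) by ring.
    move: ac bc; rewrite !ler_norml => /andP[a1 a2] /andP[b1 b2].
    have A1 := ler_wpM2l (ltW t0) a1; have A2 := ler_wpM2l (ltW t0) a2.
  have t1' : 0 <= 1 - th by rewrite subr_ge0 ltW.
  have B1 := ler_wpM2l t1' b1; have B2 := ler_wpM2l t1' b2.
  by apply/andP; split; lra.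
  have [w Kw] := fin _ mid.
  have := cgf_convex (mZ x) (ltW a0) (ltW b0) th01 c0 Ka Kb.
  by rewrite /f /K Kw Ka Kb lee_fin.
have near_c : \forall s \near c, s^-1 * Rintegral mu setT (f s) = fine (L s).
  exists (e / 2) => // s /=; rewrite distrC => /ltW sc.
  have [s0 _] := De' _ sc.
  by rewrite LE// -/(H s) H_f ?iK// fineM// integrable_fin_num//; exact/f_int/iK.
apply: (near_eq_derivable near_c).
have [c0 _] := De' _ cc.
apply: derivableM dR; apply: derivableV; last exact: derivable_id.
by rewrite gt_eqF.
Qed.

(** * Monotonicity and minima for nonnegative [Z] *)

Hypothesis Z0 : forall x t, (0 <= Z x t)%E.

Let K0 c x : 0 <= c -> (0 <= K c x)%E.
Proof. by move=> c0; exact: cgf_ge0. Qed.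

Lemma mixture_ge0 c : 0 < c -> (0 <= L c)%E.
Proof.
move=> c0; rewrite LE//; apply: mule_ge0; first by rewrite lee_fin invr_ge0 ltW.
by apply: integral_ge0 => x _; exact/K0/ltW.
Qed.

Let H_scale k c : 0 <= k -> 0 < c ->
  (\int[mu]_x (k%:E * K c x) = k%:E * H c)%E.
Proof.
move=> k0 c0; rewrite ge0_integralZl_EFin//; last exact: mK.
by move=> x _; exact/K0/ltW.
Qed.

(** With [1 / c] moved under the integral, [cgf_div_nondecreasing] compares the integrands. *)
Lemma mixture_nondecreasing a b : 0 < a -> a <= b -> (L a <= L b)%E.
Proof.
move=> a0 ab; have b0 := lt_le_trans a0 ab.
have LI c : 0 < c -> L c = (\int[mu]_x (c^-1%:E * K c x))%E.
  by move=> c0; rewrite (LE c0) [RHS]H_scale// invr_ge0 ltW.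
rewrite (LI _ a0) (LI _ b0).
apply: ge0_le_integral => //.
- by move=> x _; rewrite mule_ge0 ?lee_fin ?invr_ge0 ?(ltW a0)//; exact/K0/ltW.
- by apply: measurable_funeM; exact: mK.
- by apply: measurable_funeM; exact: mK.
- by move=> x _; exact: cgf_div_nondecreasing.
Qed.

(** If [L <= r] held on [(0, c)], monotone convergence along points increasing to [c] would give
    [c * L c <= c * r]. *)
Let mixture_lsc c (r : R) : 0 < c -> (r%:E < L c)%E ->
  exists2 c', 0 < c' < c & (r%:E < L c')%E.
Proof.
move=> c0 rc; apply: contrapT => nex.
(* The denominator [n + 2] keeps [u 0] positive. *)
pose u n : R := c - c / n.+2%:R.
have uc n : 0 < u n < c.
  rewrite /u subr_gt0 ltr_pdivrMr// ltr_pMr// ltr1n/=.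
  by rewrite ltrBlDr ltrDl divr_gt0.
have u0 n : 0 < u n by case/andP: (uc n).
have Lu n : (L (u n) <= r%:E)%E.
  by rewrite leNgt; apply/negP => ru; apply: nex; exists (u n).
have r0 : 0 <= r by rewrite -lee_fin (le_trans (mixture_ge0 (u0 0%N))).
have nd : nondecreasing_seq u.
  move=> n m nm; rewrite lerD2l lerN2 ler_pM2l// lef_pV2 ?posrE//.
  by rewrite ler_nat !ltnS.
have ucv : u n @[n --> \oo] --> c.
  rewrite -[X in _ --> X]subr0 -(mulr0 c); apply: cvgB; first exact: cvg_cst.
  apply: cvgM; first exact: cvg_cst.
  have := @cvg_harmonic R; rewrite -(cvg_shiftn 1).
  by under [X in X @ _ --> _]eq_fun do rewrite addn1.
have : (H c <= (c * r)%:E)%E.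
  have -> : H c = (\int[mu]_x limn (fun n => K (u n) x))%E.
    by apply: eq_integral => x _; exact: cgf_limn.
  rewrite monotone_convergence//; last 3 first.
  - by move=> n; exact: mK.
  - by move=> n x _; exact/K0/ltW.
  - by move=> x _ n m nm; apply: cgf_nondecreasing => //; exact: nd.
  apply: lime_le.
    apply: ereal_nondecreasing_is_cvgn => n m nm; apply: ge0_le_integral => //.
    - by move=> x _; exact/K0/ltW.
    - exact: mK.
    - exact: mK.
    - by move=> x _; apply: cgf_nondecreasing => //; exact: nd.
  apply: nearW => n; rewrite -[leLHS]/(H (u n)) HE// EFinM.
  apply: lee_pmul; rewrite ?lee_fin ?(ltW (u0 n)) ?mixture_ge0//.
  by case/andP: (uc n) => _ /ltW.
rewrite HE// EFinM lee_pmul2l// ?lte_fin//.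
by rewrite leNgt rc.
Qed.

(** Extends [cgf_convex] to infinite values: no term on the right is [-oo], so one infinite term
    makes the sum [+oo]. *)
Let K_cvx a b th x : 0 < a -> 0 < b -> 0 < th < 1 ->
  (K (th * a + (1 - th) * b) x <= th%:E * K a x + (1 - th)%:E * K b x)%E.
Proof.
move=> a0 b0 th01; have /andP[t0 t1] := th01.
have t1' : 0 < 1 - th by rewrite subr_gt0.
have := K0 x (ltW a0); have := K0 x (ltW b0).
case Kb : (K b x) => [z| |]// z0.
  case Ka : (K a x) => [y| |]// y0.
    rewrite -!EFinM -EFinD; apply: cgf_convex => //; [exact: ltW|exact: ltW|].
    by rewrite addr_gt0// mulr_gt0.
  by rewrite gt0_muley ?lte_fin// addye ?leey// -EFinM.
move=> y0; rewrite (@gt0_muley _ (1 - th)%:E) ?lte_fin// addey ?leey//.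
by rewrite gt_eqF// (lt_le_trans (@ltNy0 R))// mule_ge0// lee_fin ltW.
Qed.

Let mixture_cvx a b th x y : 0 < a -> 0 < b -> 0 < th < 1 ->
  L a = x%:E -> L b = y%:E ->
  ((th * a + (1 - th) * b)%:E * L (th * a + (1 - th) * b) <=
    (th * (a * x) + (1 - th) * (b * y))%:E)%E.
Proof.
move=> a0 b0 th01 La Lb; have /andP[t0 t1] := th01.
have t1' : 0 < 1 - th by rewrite subr_gt0.
have c0 : 0 < th * a + (1 - th) * b by rewrite addr_gt0// mulr_gt0.
rewrite -HE// EFinD (EFinM th) (EFinM (1 - th)) (EFinM a) (EFinM b) -La -Lb -!HE//.
rewrite -(H_scale (ltW t0) a0) -(H_scale (ltW t1') b0).
rewrite -ge0_integralD//; last 4 first.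
- by move=> ? _; rewrite mule_ge0 ?lee_fin ?(ltW t0)//; exact/K0/ltW.
- by apply: measurable_funeM; exact: mK.
- by move=> ? _; rewrite mule_ge0 ?lee_fin ?(ltW t1')//; exact/K0/ltW.
- by apply: measurable_funeM; exact: mK.
apply: ge0_le_integral => //.
- by move=> ? _; exact/K0/ltW.
- exact: mK.
- by apply: emeasurable_funD; apply: measurable_funeM; exact: mK.
- by move=> t _; exact: K_cvx.
Qed.

(** The gap [g] in midpoint convexity is nonnegative almost everywhere and has integral 0, so
    [cgf_midpoint_eq] applies at almost every point. Integrating its conclusion gives
    [b * (a * x) = a * (b * y)]. *)
Let mixture_strict a b x y : 0 < a -> a < b -> L a = x%:E -> L b = y%:E ->
  (((a + b) / 2)%:E * L ((a + b) / 2) = ((a * x + b * y) / 2)%:E)%E -> x = y.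
Proof.
move=> a0 ab La Lb; set m := (a + b) / 2; have b0 := lt_trans a0 ab.
have m0 : 0 < m by rewrite divr_gt0// addr_gt0.
rewrite -HE// => Hm.
have iK c v : 0 < c -> L c = v%:E -> mu.-integrable setT (K c).
  by move=> c0 Lc; apply: K_int; rewrite // Lc ?ltNyr ?ltry.
have ia := iK _ _ a0 La; have ib := iK _ _ b0 Lb.
have im : mu.-integrable setT (K m).
  apply: (iK _ (m^-1 * ((a * x + b * y) / 2))) => //.
  by rewrite LE// -/(H m) Hm.
pose g x := ((2^-1)%:E * (f a x)%:E + (2^-1)%:E * (f b x)%:E - (f m x)%:E)%E.
have iga := integrableZl measurableT 2^-1 (f_int ia).
have igb := integrableZl measurableT 2^-1 (f_int ib).
have ig : mu.-integrable setT g.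
  exact: integrableB (integrableD measurableT iga igb) (f_int im).
have int_g : (\int[mu]_x g x = 0)%E.
  rewrite integralB//; [|exact: integrableD|exact: f_int].
  rewrite integralD// !integralZl//; [|exact: f_int..].
  rewrite -!H_f// Hm !HE// La Lb -!EFinM -EFinD; congr _%:E.
  by field.
have ae_fin : {ae mu, forall x, [/\ K a x = (f a x)%:E, K b x = (f b x)%:E &
    K m x = (f m x)%:E]}.
  apply: filterS3 (integrable_ae measurableT ia) (integrable_ae measurableT ib)
    (integrable_ae measurableT im) => t /(_ Logic.I) ta /(_ Logic.I) tb /(_ Logic.I) tm.
  by rewrite /f (fineK ta) (fineK tb) (fineK tm).
have h01 : 0 < (2^-1 : R) < 1 by apply/andP; split; lra.
have mE : m = 2^-1 * a + (1 - 2^-1) * b by rewrite /m; field.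
have h2 : 1 - 2^-1 = 2^-1 :> R by field.
have ae_g0 : {ae mu, forall x, (0 <= g x)%E}.
  apply: filterS ae_fin => t [ta tb tm].
  have := K_cvx t a0 b0 h01; rewrite -mE h2 ta tb tm /g.
  by rewrite -!EFinM -!EFinD !lee_fin subr_ge0.
have /ae_eq_integral_abs : (\int[mu]_x `|g x| = 0)%E.
  rewrite -[RHS]int_g; apply: ae_eq_integral => //.
  - by apply: measurableT_comp => //; exact: measurable_int ig.
  - exact: measurable_int ig.
  - by apply: filterS ae_g0 => t gt _; rewrite gee0_abs.
move=> /(_ measurableT (measurable_int _ ig)) ae_g.
have : (b%:E * H a = a%:E * H b)%E.
  have HfZ k c : mu.-integrable setT (K c) ->
      (\int[mu]_x (k%:E * (f c x)%:E) = k%:E * H c)%E.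
    by move=> i; rewrite (H_f i) integralZl//; exact: f_int.
  rewrite -(HfZ b a ia) -(HfZ a b ib).
  have mf c : mu.-integrable setT (K c) ->
      measurable_fun setT (fun x => (f c x)%:E).
    by move=> /f_int; exact: measurable_int.
  apply: ae_eq_integral => //; [exact/measurable_funeM/mf..|].
  apply: filterS2 ae_fin ae_g => t [ta tb tm] /(_ Logic.I) gt _.
  rewrite -!EFinM; congr _%:E.
  apply: (cgf_midpoint_eq (mZ t) (Z0 t) a0 ab ta tb).
  rewrite -/m -/(K m t) tm; congr _%:E.
  move: gt; rewrite /g -!EFinM -!EFinD => -[] gt.
  by lra.
rewrite !HE// La Lb -!EFinM => -[].
rewrite mulrCA => /(mulfI (negbT (gt_eqF a0))) /(mulfI (negbT (gt_eqF b0))).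
exact.
Qed.

Lemma mixture_cvg0 : cvg (L t @[t --> 0^'+]) /\
  (forall a b : R, 0 <= a -> a <= b -> (extend0 L a <= extend0 L b)%E).
Proof.
have cv : cvg (L t @[t --> 0^'+]).
  apply: nondecreasing_at_right_is_cvge; near=> x => a b.
  rewrite !in_itv/= => /andP[a0 _] _ ab; exact: mixture_nondecreasing.
split=> // a b; rewrite /extend0 le_eqVlt => /predU1P[<-|a0] ab.
  rewrite eqxx; case: eqVneq => // b0.
  have {ab} b_gt0 : 0 < b by rewrite lt0r b0.
  apply: lime_le => //; near=> t; apply: mixture_nondecreasing.
    by near: t; exact: nbhs_right_gt.
  by near: t; exact: nbhs_right_le.
rewrite !gt_eqF//; last exact: lt_le_trans ab.
exact: mixture_nondecreasing.
Unshelve. all: by end_near. Qed.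

Lemma mixture_local_min B : 0 < B -> (finite_domain L)° !=set0 ->
  exists! c, (0 < c)%E /\ local_min_at L B c.
Proof.
move=> B0 [c /interior_subset [c0 Lc]].
have [l [l0 lmin]] := exists_local_min B0 mixture_ge0 mixture_nondecreasing
  mixture_lsc (ex_intro2 _ _ c c0 Lc).
exists l; split=> // l' [l'0 lmin'].
case: l l' l0 l'0 lmin lmin' => [l| |] [l'| |]// _ _ lmin lmin'.
- congr _%:E; apply: (local_min_real_unique B0 mixture_ge0 _ mixture_strict lmin lmin').
  exact: mixture_cvx.
- by have := local_min_pinfty_unique B0 mixture_ge0 mixture_nondecreasing
    mixture_cvx lmin lmin'.
- by have := local_min_pinfty_unique B0 mixture_ge0 mixture_nondecreasing
    mixture_cvx lmin' lmin.
Qed.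

End Mixture.

(** * Reduction of the three functionals *)

(** [nonneg] stands for [F >= 0], from which each functional derives nonnegativity of its own
    [Z]. *)
Lemma mixture_proposition dX dT (X : measurableType dX) (T : measurableType dT)
    (R : realType) (mu : probability X R) (P : probability T R)
    (Z : X -> T -> \bar R) (L : R -> \bar R) (nonneg : Prop) :
  (forall x, measurable_fun [set: T] (Z x)) ->
  (forall c, 0 < c -> measurable_fun [set: X] (fun x => cgf P (Z x) c)) ->
  (forall c, 0 < c -> L c = (c^-1%:E * mixture_cgf mu P Z c)%E) ->
  (forall c, 0 < c -> (-oo < L c)%E) ->
  (finite_domain L)° !=set0 ->
  (nonneg -> forall x t, (0 <= Z x t)%E) ->
  [/\ forall c : R, (finite_domain L)° c ->
        derivable (fun t : R => fine (L t)) c 1,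
      nonneg ->
        cvg (L t @[t --> 0^'+]) /\
        (forall a b : R, 0 <= a -> a <= b -> (extend0 L a <= extend0 L b)%E)
    & nonneg ->
        forall B : R, 0 < B ->
        exists! c : \bar R, (0 < c)%E /\ local_min_at L B c].
Proof.
move=> mZ mK LE Ly D0 Z0; split.
- by move=> c Dc; exact: (derivable_mixture mZ mK LE Ly Dc).
- by move=> /Z0{}Z0; exact: (mixture_cvg0 mZ mK LE Z0).
- by move=> /Z0{}Z0 B B0; exact: (mixture_local_min mZ mK LE Z0 B0 D0).
Qed.

(** A positive [c] scales positive and negative parts separately; if both have infinite integral,
    the two sides share the value [-oo]. *)
Lemma integralZl_gt0 d (T : measurableType d) (R : realType)
    (mu : {measure set T -> \bar R}) (g : T -> \bar R) (c : R) :
  0 < c -> measurable_fun [set: T] g ->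
  (\int[mu]_t (c%:E * g t) = c%:E * \int[mu]_t g t)%E.
Proof.
move=> c0 mg; rewrite integralE [in RHS]integralE.
have p : (fun t => c%:E * g t)^\+%E = (fun t => c%:E * g^\+ t)%E.
  by apply/funext => t; rewrite !funeposE maxeMr ?mule0// lee_fin ltW.
have n : (fun t => c%:E * g t)^\-%E = (fun t => c%:E * g^\- t)%E.
  by apply/funext => t; rewrite !funenegE -muleN maxeMr ?mule0// lee_fin ltW.
rewrite p n !ge0_integralZl_EFin//; last 4 first.
- exact: measurable_funeneg.
- exact: ltW.
- exact: measurable_funepos.
- exact: ltW.
have : (0 <= \int[mu]_t g^\- t)%E by exact: integral_ge0.
have : (0 <= \int[mu]_t g^\+ t)%E by exact: integral_ge0.
case: (\int[mu]_t g^\+ t)%E => [a| |]// a0; case: (\int[mu]_t g^\- t)%E => [b| |]// b0.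
- by rewrite -!EFinM -!EFinB mulrBr.
- by rewrite gt0_muley ?lte_fin// !addeNy gt0_muleNy ?lte_fin.
- by rewrite addye// gt0_muley ?lte_fin// addye.
- by rewrite gt0_muley ?lte_fin// !addeNy gt0_muleNy ?lte_fin.
Qed.

Lemma mixture_cgf_cst dX dT (X : measurableType dX) (T : measurableType dT)
    (R : realType) (mu : probability X R) (P : probability T R)
    (Z : T -> \bar R) (c : R) :
  mixture_cgf mu P (fun=> Z) c = cgf P Z c.
Proof.
rewrite /mixture_cgf integral_cst//.
by rewrite [X in (_ * X)%E]probability_setT mule1.
Qed.

(** Tonelli's theorem applied to the positive and negative parts of [f]. *)
Lemma measurable_integral1 d1 d2 (T1 : measurableType d1) (T2 : measurableType d2)
    (R : realType) (m : probability T1 R) (f : T1 * T2 -> \bar R) :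
  measurable_fun [set: T1 * T2] f ->
  measurable_fun [set: T2] (fun y => \int[m]_x f (x, y))%E.
Proof.
move=> mf.
under eq_fun do rewrite integralE.
apply: emeasurable_funB.
- have := measurable_fun_fubini_tonelli_G (m1 := m) _ (measurable_funepos mf)
    (funepos_ge0 f).
  congr (measurable_fun _ _); apply/funext => y; apply: eq_integral => x _.
  by rewrite !funeposE.
- have := measurable_fun_fubini_tonelli_G (m1 := m) _ (measurable_funeneg mf)
    (funeneg_ge0 f).
  congr (measurable_fun _ _); apply/funext => y; apply: eq_integral => x _.
  by rewrite !funenegE.
Qed.

Theorem proposition3 (R : realType) (X Y : ptopologicalType)
    (polishX : polish R X) (polishY : polish R Y)
    (mu : probability (borel X) R) (gamma : probability (borel Y) R)
    (F : X * Y -> R)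
    (mF : measurable_fun [set: borel (X * Y)%type]
            (F : borel (X * Y)%type -> R))
    (k : functional)
    (wd : forall c : R, 0 < c ->
       well_defined mu gamma F k c /\ (-oo < L_ mu gamma F k c)%E)
    (D0 : (finite_domain (L_ mu gamma F k))° !=set0) :
  let L := L_ mu gamma F k in
  [/\ forall c : R, (finite_domain L)° c ->
        derivable (fun t : R => fine (L t)) c 1,
      (forall x y, 0 <= F (x, y)) ->
        cvg (L t @[t --> 0^'+]) /\
        (forall a b : R, 0 <= a -> a <= b ->
           (extend0 L a <= extend0 L b)%E)
    & (forall x y, 0 <= F (x, y)) ->
        forall B : R, 0 < B ->
        exists! c : \bar R, (0 < c)%E /\ local_min_at L B c].
Proof.
move=> L.
(* Iterated integration needs measurability for the product sigma-algebra, whereas [mF] is about the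
   Borel sets of the product topology. *)
have mFXY := measurable_fun_borel_prod polishX polishY mF.
have mFE : measurable_fun [set: (borel X * borel Y)%type] (fun t => (F t)%:E).
  exact/measurable_EFinP.
have Ly c : 0 < c -> (-oo < L c)%E by move=> /wd[].
have mexp c : measurable_fun [set: (borel X * borel Y)%type]
    (fun t => expeR (c%:E * (F t)%:E)%E) by exact: measurable_expeRZ.
rewrite {}/L in Ly *; case: k wd D0 Ly => _ D0 Ly.
(* For [Lambda], Tonelli's theorem turns the iterated integral into one over the product measure. *)
- apply: (@mixture_proposition _ _ (borel X) (borel X * borel Y)%type R
    mu (mu \x gamma)%E (fun _ t => (F t)%:E)) => //.
  + move=> c c0; rewrite mixture_cgf_cst /L_ /cgf /mgf fubini_tonelli1//.
    by move=> t; exact: expeR_ge0.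
  + by move=> F0 _ [x y]; rewrite lee_fin.
- have mm := measurable_integral1 mu mFE.
  apply: (@mixture_proposition _ _ (borel X) (borel Y) R
    mu gamma (fun _ y => \int[mu]_x (F (x, y))%:E)%E) => //.
  + move=> c c0; rewrite mixture_cgf_cst /L_ /cgf /mgf.
    congr (_ * lne _)%E; apply: eq_integral => y _; congr expeR.
    under eq_integral do rewrite EFinM.
    rewrite integralZl_gt0//.
    exact: (measurable_fun_pair1 y mFE).
  + by move=> F0 _ y; apply: integral_ge0 => x _; rewrite lee_fin.
- apply: (@mixture_proposition _ _ (borel X) (borel Y) R
    mu gamma (fun x y => (F (x, y))%:E)) => //.
  + move=> x; exact: (measurable_fun_pair2 x mFE).
  (* For [Lambda2] the family [Z] depends on [x], so measurability of the outer integrand is taken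
     from Tonelli's theorem. *)
  + move=> c c0; apply: (measurableT_comp (@measurable_lne R)).
    apply: (measurable_fun_fubini_tonelli_F (m2 := gamma) _ (mexp c)).
    by move=> t; exact: expeR_ge0.
Qed.
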